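(* Let $n$ be a positive integer. The number $n!$ is a $4$-layered number if and only if $n\ge 9$.
   Context: A positive integer $N$ is $4$-layered if the set of all positive divisors of $N$ can be partitioned into $4$ subsets having the same sum of elements. *)

(* Defs.v *)
From mathcomp Require Import all_boot.

Set Implicit Arguments.
Unset Strict Implicit.
Unset Printing Implicit Defensive.

(* For N > 0 every positive divisor of N is at most N, and 0 does not divide N. *)
Definition divisor_set (N : nat) : {set 'I_N.+1} := [set d : 'I_N.+1 | d %| N].

(* The blocks of a [partition] are nonempty, which loses nothing here: the
   common block sum is positive because the divisors are. *)
Definition layered (k N : nat) : Prop :=
  0 < N /\
  exists P : {set {set 'I_N.+1}},
    [/\ partition P (divisor_set N),
        #|P| = k
      & forall A B : {set 'I_N.+1}, A \in P -> B \in P ->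
          \sum_(d in A) (d : nat) = \sum_(d in B) (d : nat)].

(* Main.v *)
Require Import Defs.
From mathcomp Require Import all_boot zify.
From Stdlib Require Import NArith.

(* If n <= 8 then sigma(n!) < 4 n!, whereas the block containing n! has sum at
   least n!.

   For n >= 9, multiplying by a number coprime to N keeps N 4-layered, and the
   multiset {p^i : i < l} splits as {p^i : i < l1} and p^l1 {p^i : i < l - l1}, so
   only bounded exponents of 3, 5 and 7 matter. The exponent of 2 is unbounded.
   For it, the divisors 2^i u with u in {1, 3, 5, 7} are set aside: by induction on
   the number of powers of 2, fixing parities at each step, they realise every
   almost balanced quadruple of bin sums, with a tolerance growing like 2^i. The
   other divisors are distributed greedily, by computation for finitely many
   exponents, within that tolerance. So the divisors of X = 2^a 3^b 5^c 7^d realise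
   every quadruple of sums with total sigma(X) close enough to the mean.

   This settles 9 <= n <= 13, where 7 divides n! exactly once and 4 | sigma(n!).
   For n >= 14, Erdos' proof of Bertrand's postulate gives two odd primes p < q in
   (n/2, n], each dividing n! exactly once. The deviations in the four copies of
   the divisors of X, scaled by 1, p, q and pq, can then be chosen to cancel even
   if 4 does not divide sigma(X). *)

Set Implicit Arguments.
Unset Strict Implicit.
Unset Printing Implicit Defensive.

(** * Splitting multisets into bins *)

(** [w] attaches a bin to each entry, so equal entries may go to different bins. *)
Definition splits k (s : seq nat) (t : 'I_k -> nat) : Prop :=
  exists w : seq (nat * 'I_k),
    perm_eq s (map fst w) /\ forall i, \sum_(x <- w | x.2 == i) x.1 = t i.

Definition balanced k (s : seq nat) : Prop :=
  exists c, @splits k s (fun=> c).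

Definition prods (s s' : seq nat) : seq nat := [seq x * y | x <- s, y <- s'].

(** [l] counts the powers: the divisors of a prime power [p ^ e] are [powers p e.+1]. *)
Definition powers (k l : nat) : seq nat := [seq k ^ i | i <- iota 0 l].

Section Splits.
Variable k : nat.
Implicit Types (s : seq nat) (t : 'I_k -> nat).

Lemma eq_splits s t t' : t =1 t' -> splits s t -> splits s t'.
Proof.
by move=> tt' [w [sw wt]]; exists w; split=> // i; rewrite wt tt'.
Qed.

Lemma perm_splits s s' t : perm_eq s s' -> splits s t -> splits s' t.
Proof.
move=> ss' [w [sw wt]]; exists w; split=> //.
by rewrite perm_sym in ss'; apply: perm_trans ss' sw.
Qed.

Lemma splits_nil : @splits k [::] (fun=> 0).
Proof. by exists [::]; split=> // i; rewrite big_nil. Qed.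

Lemma splits_cat s s' t t' :
  splits s t -> splits s' t' -> splits (s ++ s') (fun i => t i + t' i).
Proof.
move=> [w [sw wt]] [w' [sw' wt']]; exists (w ++ w'); split.
  by rewrite map_cat perm_cat.
by move=> i; rewrite big_cat /= wt wt'.
Qed.

Lemma splits_scale e s t :
  splits s t -> splits (map (muln e) s) (fun i => e * t i).
Proof.
move=> [w [sw wt]]; exists [seq (e * x.1, x.2) | x <- w]; split.
  by rewrite -map_comp (map_comp (muln e) fst w : map _ w = _) perm_map.
by move=> i; rewrite big_map /= -wt big_distrr.
Qed.

Lemma splits_cons x (j : 'I_k) s t :
  splits s t -> splits (x :: s) (fun i => t i + (j == i) * x).
Proof.
move=> [w [sw wt]]; exists ((x, j) :: w); split; first by rewrite /= perm_cons.
by move=> i; rewrite big_cons /= wt; case: eqP; lia.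
Qed.

Lemma splits_sumn s t : splits s t -> sumn s = \sum_i t i.
Proof.
move=> [w [sw wt]]; rewrite (perm_sumn sw) sumnE big_map.
rewrite [RHS](eq_bigr (fun i => \sum_(x <- w | x.2 == i) x.1)) => [|i _]; last first.
  by rewrite wt.
rewrite (exchange_big_dep xpredT) //=.
by apply: eq_bigr => x _; rewrite (big_pred1 x.2) // => i; rewrite eq_sym.
Qed.

End Splits.

Section Balanced.
Variable k : nat.

Lemma perm_balanced s s' : perm_eq s s' -> balanced k s -> balanced k s'.
Proof. by move=> ss' [c sc]; exists c; apply: perm_splits sc. Qed.

Lemma balanced_nil : balanced k [::].
Proof. by exists 0; apply: splits_nil. Qed.

Lemma balanced_cat s s' : balanced k s -> balanced k s' -> balanced k (s ++ s').
Proof. by move=> [c sc] [c' sc']; exists (c + c'); apply: splits_cat. Qed.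

Lemma balanced_scale e s : balanced k s -> balanced k (map (muln e) s).
Proof. by move=> [c sc]; exists (e * c); apply: splits_scale. Qed.

End Balanced.

(** * Product multisets and the divisors of a product *)

Lemma prods_cons x s s' : prods (x :: s) s' = map (muln x) s' ++ prods s s'.
Proof. by []. Qed.

Lemma prods_catl s1 s2 s' : prods (s1 ++ s2) s' = prods s1 s' ++ prods s2 s'.
Proof. exact: allpairs_cat. Qed.

Lemma prods_scale e s s' : prods (map (muln e) s) s' = map (muln e) (prods s s').
Proof.
rewrite /prods allpairs_mapl map_allpairs.
by apply: eq_allpairs => x y; rewrite mulnA.
Qed.

Lemma prodsA s1 s2 s3 : prods (prods s1 s2) s3 = prods s1 (prods s2 s3).
Proof.
elim: s1 => //= x s1 IH.
by rewrite !prods_cons prods_catl prods_scale IH.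
Qed.

Lemma prodsC s s' : perm_eq (prods s s') (prods s' s).
Proof.
elim: s => [|x s IH]; first by rewrite /prods allpairs0r.
rewrite prods_cons perm_sym (perm_allpairs_consr muln s' (fun=> x) (fun=> s)) perm_sym.
by rewrite (eq_map (mulnC x)) perm_cat.
Qed.

Lemma perm_prods s1 s2 s1' s2' : perm_eq s1 s2 -> perm_eq s1' s2' ->
  perm_eq (prods s1 s1') (prods s2 s2').
Proof. by move=> h h'; apply: perm_allpairs. Qed.

Lemma prods_catr s1 s2 s' :
  perm_eq (prods s' (s1 ++ s2)) (prods s' s1 ++ prods s' s2).
Proof.
by rewrite (permPl (prodsC _ _)) prods_catl perm_cat // prodsC.
Qed.

Lemma prodsCA s1 s2 s3 :
  perm_eq (prods s1 (prods s2 s3)) (prods s2 (prods s1 s3)).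
Proof. by rewrite -!prodsA perm_prods // prodsC. Qed.

Lemma sumn_prods s s' : sumn (prods s s') = sumn s * sumn s'.
Proof.
have sumn_scale e r : sumn (map (muln e) r) = e * sumn r.
  by rewrite !sumnE big_map big_distrr.
by elim: s => //= x s IH; rewrite prods_cons sumn_cat sumn_scale IH mulnDl.
Qed.

(** Each entry of [s'] scales a copy of [s], and each scaled copy is balanced by itself. With
    divisors of coprime numbers, this passes from a factor to the product. *)
Lemma balanced_prods k s s' : balanced k s -> balanced k (prods s s').
Proof.
move=> bs; apply: (perm_balanced (prodsC s' s)); elim: s' => [|x s' IH].
  exact: balanced_nil.
by rewrite prods_cons; apply: balanced_cat IH; apply: balanced_scale.
Qed.

Lemma powersD k l l' :
  powers k (l + l') = powers k l ++ map (muln (k ^ l)) (powers k l').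
Proof.
rewrite /powers iotaD map_cat add0n -[in iota l l'](addn0 l) iotaDl -!map_comp.
by congr (_ ++ _); apply: eq_map => i /=; rewrite expnD.
Qed.

Lemma balanced_powersD r k l l' s : balanced r (prods (powers k l) s) ->
  balanced r (prods (powers k l') s) ->
  balanced r (prods (powers k (l + l')) s).
Proof.
move=> bl bl'; rewrite powersD prods_catl prods_scale.
by apply: balanced_cat bl _; apply: balanced_scale.
Qed.

(* Every length at least L is a sum of lengths in [L, 2L). *)
Lemma balanced_powers_tile r k L s : 0 < L ->
  (forall l, L <= l < L.*2 -> balanced r (prods (powers k l) s)) ->
  forall l, L <= l -> balanced r (prods (powers k l) s).
Proof.
move=> L0 base; elim/ltn_ind => l IH Ll.
have [lt|ge] := ltnP l L.*2; first by apply: base; rewrite Ll.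
rewrite -(subnKC Ll); apply: balanced_powersD; first by apply: base; lia.
by apply: IH; lia.
Qed.

Lemma divisorsM m n : 0 < m -> 0 < n -> coprime m n ->
  perm_eq (divisors (m * n)) (prods (divisors m) (divisors n)).
Proof.
move=> m0 n0 cop; apply: uniq_perm; first exact: divisors_uniq.
  apply: allpairs_uniq; try exact: divisors_uniq.
  move=> [a b] [c d] /allpairsP [[a' b'] /= [ha hb [-> ->]]].
  move=> /allpairsP [[c' d'] /= [hc hd [-> ->]]] e.
  rewrite -!dvdn_divisors // in ha hb hc hd.
  (* The two factors of a product are recovered as its gcds with [m] and [n]. *)
  have gm x y : x %| m -> y %| n -> gcdn m (x * y) = x.
    move=> xm yn; rewrite Gauss_gcdl ?(coprime_dvdr yn) //.
    exact/gcdn_idPr.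
  have gn x y : x %| m -> y %| n -> gcdn n (x * y) = y.
    move=> xm yn; rewrite mulnC Gauss_gcdl; first exact/gcdn_idPr.
    by rewrite coprime_sym (coprime_dvdl xm).
  by congr (_, _); [rewrite -(gm a' b') // e gm | rewrite -(gn a' b') // e gn].
move=> d; rewrite -dvdn_divisors ?muln_gt0 ?m0 //.
apply/idP/allpairsP => [dmn|[[a b] /= [ha hb ->]]]; last first.
  by rewrite -!dvdn_divisors // in ha hb; apply: dvdn_mul.
exists (gcdn d m, gcdn d n); rewrite -!dvdn_divisors //= !dvdn_gcdr; split=> //.
apply/eqP; rewrite eqn_dvd; apply/andP; split.
  rewrite muln_gcdl !muln_gcdr !dvdn_gcd dmn.
  by rewrite dvdn_mull // dvdn_mulr // dvdn_mull.
rewrite Gauss_dvd ?dvdn_gcdl //.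
exact: coprime_dvdl (dvdn_gcdr _ _) (coprime_dvdr (dvdn_gcdr _ _) cop).
Qed.

Lemma divisors_pfactor p e : prime p ->
  perm_eq (divisors (p ^ e)) (powers p e.+1).
Proof.
move=> pp; have p1 := prime_gt1 pp; have p0 := prime_gt0 pp.
apply: uniq_perm; first exact: divisors_uniq.
  by rewrite map_inj_uniq ?iota_uniq // => i j; apply: expnI.
move=> d; rewrite -dvdn_divisors ?expn_gt0 ?p0 //.
apply/dvdn_pfactor/mapP => //.
  by case=> m le ->; exists m; rewrite // mem_iota ltnS.
by case=> m; rewrite mem_iota ltnS => le ->; exists m.
Qed.

(** * Four bins *)

Definition load (a b c d : nat) : 'I_4 -> nat :=
  fun i => nth 0 [:: a; b; c; d] i.

Lemma eq_ord4 (f g : 'I_4 -> nat) :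
  f (inord 0) = g (inord 0) -> f (inord 1) = g (inord 1) ->
  f (inord 2) = g (inord 2) -> f (inord 3) = g (inord 3) -> f =1 g.
Proof.
move=> h0 h1 h2 h3 i; rewrite -(inord_val i).
by case: i => [[|[|[|[|]]]]].
Qed.

Lemma splits_cons4 x s a b c d :
  splits s (load a b c d) ->
  [/\ splits (x :: s) (load (a + x) b c d),
      splits (x :: s) (load a (b + x) c d),
      splits (x :: s) (load a b (c + x) d)
    & splits (x :: s) (load a b c (d + x))].
Proof.
have idx (j : nat) (e : 'I_4 -> nat) : j < 4 -> splits s (load a b c d) ->
    (fun i => load a b c d i + (inord j == i) * x) =1 e -> splits (x :: s) e.
  by move=> j4 sp /eq_splits; apply; apply: splits_cons.
move=> sp; split.
- by apply: (idx 0) => //; apply: eq_ord4; rewrite /load -!val_eqE /= !inordK //=; lia.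
- by apply: (idx 1) => //; apply: eq_ord4; rewrite /load -!val_eqE /= !inordK //=; lia.
- by apply: (idx 2) => //; apply: eq_ord4; rewrite /load -!val_eqE /= !inordK //=; lia.
- by apply: (idx 3) => //; apply: eq_ord4; rewrite /load -!val_eqE /= !inordK //=; lia.
Qed.

Lemma load_nil : splits [::] (load 0 0 0 0).
Proof.
by apply: eq_splits (@splits_nil 4); apply: eq_ord4; rewrite /load !inordK.
Qed.

Lemma load_cat s s' a b c d a' b' c' d' :
  splits s (load a b c d) -> splits s' (load a' b' c' d') ->
  splits (s ++ s') (load (a + a') (b + b') (c + c') (d + d')).
Proof.
move=> sp sp'; apply: eq_splits (splits_cat sp sp').
by apply: eq_ord4; rewrite /load !inordK.
Qed.

Lemma load_scale e s a b c d : splits s (load a b c d) ->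
  splits (map (muln e) s) (load (e * a) (e * b) (e * c) (e * d)).
Proof.
move=> sp; apply: eq_splits (splits_scale e sp).
by apply: eq_ord4; rewrite /load !inordK.
Qed.

Lemma load_sumn s a b c d : splits s (load a b c d) -> sumn s = a + b + c + d.
Proof. by move/splits_sumn->; rewrite !big_ord_recl big_ord0 /load /=; lia. Qed.

Lemma load_balanced s a : splits s (load a a a a) -> balanced 4 s.
Proof.
exists a; apply: eq_splits H.
by apply: eq_ord4; rewrite /load !inordK.
Qed.

(* Nested [if]s rather than [||], so that the search stays lazy under
   call-by-value evaluation. *)
Fixpoint packs (s : seq nat) (a b c d : nat) : bool :=
  if s is x :: s' then
    if (if x <= a then packs s' (a - x) b c d else false) then true else
    if (if x <= b then packs s' a (b - x) c d else false) then true else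
    if (if x <= c then packs s' a b (c - x) d else false) then true else
    if x <= d then packs s' a b c (d - x) else false
  else [&& a == 0, b == 0, c == 0 & d == 0].

Lemma packsP s a b c d : packs s a b c d -> splits s (load a b c d).
Proof.
elim: s a b c d => [|x s IH] a b c d /=.
  by case/and4P => /eqP-> /eqP-> /eqP-> /eqP->; apply: load_nil.
case: ifP => [|_].
  by case: ifP => // xa /IH /(splits_cons4 x) []; rewrite subnK.
case: ifP => [|_].
  by case: ifP => // xa /IH /(splits_cons4 x) []; rewrite subnK.
case: ifP => [|_].
  by case: ifP => // xa /IH /(splits_cons4 x) []; rewrite subnK.
by case: ifP => // xa /IH /(splits_cons4 x) []; rewrite subnK.
Qed.

(** * Prescribed bin sums for the numbers [2 ^ i * u] with [u] in 1, 3, 5, 7 *)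

Definition core : seq nat := [:: 1; 3; 5; 7].

(** Four odd bins take one entry each; two odd bins take 1 and 7 while 3 + 5 = 8 fills an even one;
    otherwise 1 + 7 = 3 + 5 = 8 fills two even bins. *)
Lemma core_parity a b c d : ~~ odd (a + b + c + d) ->
  exists a' b' c' d',
    [/\ splits core (load a' b' c' d'),
        [&& odd a' == odd a, odd b' == odd b, odd c' == odd c
          & odd d' == odd d]
      & [&& a' <= 8, b' <= 8, c' <= 8 & d' <= 8]].
Proof.
rewrite !oddD.
case: (odd a); case: (odd b); case: (odd c); case: (odd d) => // _.
- by exists 1, 3, 5, 7; split=> //; apply: packsP.
- by exists 1, 7, 8, 0; split=> //; apply: packsP.
- by exists 1, 8, 7, 0; split=> //; apply: packsP.
- by exists 1, 8, 0, 7; split=> //; apply: packsP.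
- by exists 8, 1, 7, 0; split=> //; apply: packsP.
- by exists 8, 1, 0, 7; split=> //; apply: packsP.
- by exists 8, 0, 1, 7; split=> //; apply: packsP.
- by exists 8, 8, 0, 0; split=> //; apply: packsP.
Qed.

(** The products [2 ^ i * u] with [i < 4], listed largest first for the search [packs]. *)
Definition core16 : seq nat :=
  [:: 56; 40; 28; 24; 20; 14; 12; 10; 8; 7; 6; 5; 4; 3; 2; 1].

(** The total is 240, so four bins of at least 55 share the remaining 20. *)
Lemma core16_packs :
  all (fun x => all (fun y => all (fun z =>
    packs core16 (55 + x) (55 + y) (55 + z) (55 + (20 - x - y - z)))
    (iota 0 (21 - x - y))) (iota 0 (21 - x))) (iota 0 21).
Proof. by vm_compute. Qed.

(** By induction on [l]: the entries with exponent 0 fix the parities, and what remains is twice an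
    instance for the previous [l]. As they load a bin by at most 8, a tolerance [t] becomes
    [2 * t - 8], which fixes the term 8 and doubles the other one. The total bounds the bins from
    above. *)
Lemma core_splits l a b c d : 4 <= l -> a + b + c + d = 16 * (2 ^ l - 1) ->
  [&& 2 ^ (l + 2) <= a + (8 + 2 ^ (l - 4)),
      2 ^ (l + 2) <= b + (8 + 2 ^ (l - 4)),
      2 ^ (l + 2) <= c + (8 + 2 ^ (l - 4))
    & 2 ^ (l + 2) <= d + (8 + 2 ^ (l - 4))] ->
  splits (prods (powers 2 l) core) (load a b c d).
Proof.
move=> l4; rewrite -(subnKC l4); move: (l - 4) => {l4}l.
rewrite addKn; elim: l a b c d => [|l IH] a b c d sum /and4P[ha hb hc hd].
  apply: (perm_splits (s := core16)); first by [].
  rewrite !expnS expn0 in sum ha hb hc hd.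
  have -> : a = 55 + (a - 55) by lia.
  have -> : b = 55 + (b - 55) by lia.
  have -> : c = 55 + (c - 55) by lia.
  have -> : d = 55 + (20 - (a - 55) - (b - 55) - (c - 55)) by lia.
  apply: packsP.
  have /allP/(_ (a - 55)) := core16_packs; rewrite mem_iota => h.
  have /allP/(_ (b - 55)) := h ltac:(lia); rewrite mem_iota => {}h.
  have /allP/(_ (c - 55)) := h ltac:(lia); rewrite mem_iota => {}h.
  by apply: h; lia.
have e6 : 2 ^ l.+1 = 2 * 2 ^ l by rewrite expnS.
have e2 : 2 ^ (4 + l.+1) = 32 * 2 ^ l by rewrite expnD e6 mulnA.
have e3 : 2 ^ (4 + l) = 16 * 2 ^ l by rewrite expnD.
have e4 : 2 ^ (4 + l.+1 + 2) = 128 * 2 ^ l by rewrite expnD e2 mulnC mulnA.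
have e5 : 2 ^ (4 + l + 2) = 64 * 2 ^ l by rewrite expnD e3 mulnC mulnA.
have l0 : 0 < 2 ^ l by rewrite expn_gt0.
rewrite e2 in sum; rewrite e4 e6 in ha hb hc hd.
have par : ~~ odd (a + b + c + d) by rewrite sum oddM.
have [a' [b' [c' [d' [sp /and4P[pa pb pc pd] /and4P[la lb lc ld]]]]]] :=
  core_parity par.
have s16 : a' + b' + c' + d' = 16 by rewrite -(load_sumn sp).
have half x x' : odd x' == odd x -> x' <= x -> x = x' + 2 * ((x - x')./2).
  by move=> /eqP ox le; rewrite mul2n -{1}(subnKC le) halfK oddB // ox addbb subn0.
have := half a a' pa ltac:(clear -ha la l0; lia); move: (_./2) => x ea.
have := half b b' pb ltac:(clear -hb lb l0; lia); move: (_./2) => y eb.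
have := half c c' pc ltac:(clear -hc lc l0; lia); move: (_./2) => z ec.
have := half d d' pd ltac:(clear -hd ld l0; lia); move: (_./2) => u ed.
clear half par pa pb pc pd; subst a b c d.
rewrite -[4 + l.+1]/(1 + (4 + l)) powersD prods_catl prods_scale.
have -> : prods (powers 2 1) core = core by [].
apply: load_cat sp _; rewrite expn1; apply: load_scale; apply: IH.
  by rewrite e3; clear -sum s16 l0; lia.
by rewrite e5; clear -la lb lc ld ha hb hc hd l0; apply/and4P; split; lia.
Qed.

(* Tolerances, here and in [near_equal], are on four times the bin sums, to avoid
   dividing the total. *)
Definition flexible (s : seq nat) (K : nat) : Prop :=
  forall a b c d, a + b + c + d = sumn s ->
    [&& sumn s <= 4 * a + K, sumn s <= 4 * b + K, sumn s <= 4 * c + K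
      & sumn s <= 4 * d + K] ->
  splits s (load a b c d).

Definition near_equal (s : seq nat) (r : nat) : Prop :=
  exists a b c d, splits s (load a b c d) /\
    [&& 4 * a <= sumn s + r, 4 * b <= sumn s + r, 4 * c <= sumn s + r
      & 4 * d <= sumn s + r].

Lemma sumn_scale e s : sumn (map (muln e) s) = e * sumn s.
Proof. by rewrite !sumnE big_map big_distrr. Qed.

Lemma sumn_powers2 l : sumn (powers 2 l) = 2 ^ l - 1.
Proof.
elim: l => // l IH; rewrite -(addn1 l) powersD sumn_cat IH /= addn0 muln1 expnD.
by have := expn_gt0 2 l; lia.
Qed.

(** The mean of the bins is [2 ^ (l + 2) - 4], so [core_splits] allows [4 + 2 ^ (l - 4)] below it;
    the tolerance here is four times that. *)
Lemma flexible_core l : 4 <= l ->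
  flexible (prods (powers 2 l) core) (16 + 2 ^ (l - 2)).
Proof.
move=> l4 a b c d; rewrite sumn_prods sumn_powers2 => sum h.
have e1 : 2 ^ (l - 2) = 4 * 2 ^ (l - 4).
  by rewrite -(expnD 2 2); congr (2 ^ _); lia.
have e2 : 2 ^ (l + 2) = 4 * 2 ^ l by rewrite expnD; lia.
have l0 := expn_gt0 2 l.
apply: core_splits => //; first by rewrite sum /=; lia.
by move: h; rewrite e1 e2 /=; lia.
Qed.

(** A near-equal distribution of [s'] is fixed, and [s] supplies what each target still lacks. The
    hypothesis [K <= sumn s] keeps the differences [a - a'] from truncating. *)
Lemma flexible_cat s s' K r : K <= sumn s -> r <= K ->
  flexible s K -> near_equal s' r -> flexible (s ++ s') (K - r).
Proof.
move=> Ks rK fl [a' [b' [c' [d' [sp' h']]]]] a b c d sum h.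
have sum' := load_sumn sp'; rewrite sumn_cat in sum h.
have -> : a = (a - a') + a' by lia.
have -> : b = (b - b') + b' by lia.
have -> : c = (c - c') + c' by lia.
have -> : d = (d - d') + d' by lia.
by apply: load_cat sp'; apply: fl; [lia|apply/and4P; split; lia].
Qed.

Lemma flexible_perm s s' K : perm_eq s s' -> flexible s K -> flexible s' K.
Proof.
move=> ss' fl a b c d; rewrite -(perm_sumn ss') => sum h.
by apply: perm_splits ss' _; apply: fl.
Qed.

Lemma flexible_balanced s K : flexible s K -> 4 %| sumn s -> balanced 4 s.
Proof.
move=> fl d4; apply: (@load_balanced _ (sumn s %/ 4)); apply: fl; first by lia.
by apply/and4P; split; lia.
Qed.

Lemma near_equal_powersD l l' s r r' :
  near_equal (prods (powers 2 l) s) r -> near_equal (prods (powers 2 l') s) r' ->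
  near_equal (prods (powers 2 (l + l')) s) (r + 2 ^ l * r').
Proof.
rewrite powersD prods_catl prods_scale.
move=> [a [b [c [d [sp h]]]]] [a' [b' [c' [d' [sp' h']]]]].
exists (a + 2 ^ l * a'), (b + 2 ^ l * b'), (c + 2 ^ l * c'), (d + 2 ^ l * d').
split; first by apply: load_cat sp _; apply: load_scale.
rewrite sumn_cat sumn_scale; move: h h' (2 ^ l) => /and4P[h1 h2 h3 h4].
by move=> /and4P[h1' h2' h3' h4'] e; apply/and4P; split; nia.
Qed.

Lemma near_equal_weaken s r r' : r <= r' -> near_equal s r -> near_equal s r'.
Proof.
move=> rr' [a [b [c [d [sp h]]]]]; exists a, b, c, d; split=> //.
by move: h => /and4P[h1 h2 h3 h4]; apply/and4P; split; lia.
Qed.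

Lemma near_equal_powers s :
  (forall l, 9 <= l < 18 -> near_equal (prods (powers 2 l) s) 32) ->
  forall l, 9 <= l -> near_equal (prods (powers 2 l) s) (2 ^ (l - 3)).
Proof.
move=> base l l9.
(* This stronger bound survives the induction: the first 9 powers cost 32, and the error of the rest
   is scaled by [2 ^ 9]. *)
suff : near_equal (prods (powers 2 l) s) (32 * (2 ^ (l - 8) - 1)).
  apply: near_equal_weaken.
  have -> : 2 ^ (l - 3) = 32 * 2 ^ (l - 8); last by lia.
  by rewrite -(expnD 2 5); congr (2 ^ _); lia.
elim/ltn_ind: l l9 => l IH l9.
have [l18|l18] := ltnP l 18.
  apply: near_equal_weaken (base l _); last by lia.
  have : 2 ^ 1 <= 2 ^ (l - 8) by rewrite leq_exp2l //; lia.
  by lia.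
have -> : l = 9 + (l - 9) by lia.
apply: near_equal_weaken (near_equal_powersD (base 9 isT) (IH (l - 9) _ _)); try lia.
have -> : 2 ^ (9 + (l - 9) - 8) = 2 * 2 ^ (l - 9).
  by rewrite -expnS; congr (2 ^ _); lia.
have -> : 2 ^ (l - 9) = 2 ^ 8 * 2 ^ (l - 9 - 8).
  by rewrite -expnD; congr (2 ^ _); lia.
have := expn_gt0 2 (l - 9 - 8); rewrite -[2 ^ 9]/512 -[2 ^ 8]/256.
by move: (2 ^ _) => e; lia.
Qed.

(** * Greedy distributions *)

(** Binary counterparts of [prods] and [powers], for evaluation by [vm_compute]. *)
Definition prodsN (s s' : seq N) : seq N := [seq N.mul x y | x <- s, y <- s'].

Definition powersN (k : N) (l : nat) : seq N :=
  [seq N.pow k (N.of_nat i) | i <- iota 0 l].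

Lemma map_prodsN s s' : map N.to_nat (prodsN s s') =
  prods (map N.to_nat s) (map N.to_nat s').
Proof.
rewrite /prodsN /prods map_allpairs allpairs_mapl allpairs_mapr.
by apply: eq_allpairs => x y; rewrite N2Nat.inj_mul.
Qed.

Lemma map_powersN k l : map N.to_nat (powersN k l) = powers (N.to_nat k) l.
Proof.
rewrite /powersN /powers -map_comp; apply: eq_map => i /=.
rewrite N2Nat.inj_pow Nat2N.id; elim: i => //= i IH.
by rewrite expnS IH.
Qed.

(** Each entry goes to a least loaded bin; on the decreasing list used by [near_equalN] this is the
    longest-processing-time rule of scheduling. *)
Fixpoint greedy (s : seq N) (a b c d : N) : N * N * N * N :=
  if s is x :: s' then
    if [&& N.leb a b, N.leb a c & N.leb a d] then greedy s' (N.add a x) b c d else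
    if N.leb b c && N.leb b d then greedy s' a (N.add b x) c d else
    if N.leb c d then greedy s' a b (N.add c x) d else
    greedy s' a b c (N.add d x)
  else (a, b, c, d).

Definition loadN (q : N * N * N * N) : 'I_4 -> nat :=
  let: (a, b, c, d) := q in
  load (N.to_nat a) (N.to_nat b) (N.to_nat c) (N.to_nat d).

(** [s0] holds the entries already placed; each new one is put in front of it, whence [catrev]. *)
Lemma greedy_splits s a b c d s0 : splits s0 (loadN (a, b, c, d)) ->
  splits (catrev (map N.to_nat s) s0) (loadN (greedy s a b c d)).
Proof.
elim: s a b c d s0 => //= x s IH a b c d s0 /(splits_cons4 (N.to_nat x)) [].
have e y z : N.to_nat y + N.to_nat z = N.to_nat (N.add y z) by lia.
rewrite !e => ha hb hc hd.
by case: ifP => _; [|case: ifP => _; [|case: ifP => _]]; apply: IH.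
Qed.

Definition near_equalN (s : seq N) (r : N) : bool :=
  let: (a, b, c, d) := greedy (sort (fun x y => N.leb y x) s) 0 0 0 0 in
  let t := N.add (N.add (N.add (N.add a b) c) d) r in
  [&& N.leb (N.mul 4 a) t, N.leb (N.mul 4 b) t, N.leb (N.mul 4 c) t
    & N.leb (N.mul 4 d) t].

Lemma near_equalP s r :
  near_equalN s r -> near_equal (map N.to_nat s) (N.to_nat r).
Proof.
rewrite /near_equalN; set s' := sort _ s.
have := @greedy_splits s' 0%N 0%N 0%N 0%N [::] load_nil.
rewrite catrevE cats0; case: (greedy _ _ _ _ _) => [[[a b] c] d] sp le.
have {}sp : splits (map N.to_nat s) (loadN (a, b, c, d)).
  apply: perm_splits sp.
  by rewrite perm_rev perm_map // /s' perm_sort.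
exists (N.to_nat a), (N.to_nat b), (N.to_nat c), (N.to_nat d); split=> //.
by rewrite (load_sumn sp); lia.
Qed.

Definition coreN : seq N := [:: 1; 3; 5; 7]%num.

Definition smoothN (b c d : nat) : seq N :=
  prodsN (prodsN (powersN 3 b) (powersN 5 c)) (powersN 7 d).

Definition smooth (b c d : nat) : seq nat :=
  prods (prods (powers 3 b) (powers 5 c)) (powers 7 d).

Definition restN (b c d : nat) : seq N := [seq x <- smoothN b c d | x \notin coreN].

Lemma perm_smooth b c d :
  map N.to_nat (smoothN b c d) = smooth b c d.
Proof. by rewrite !map_prodsN !map_powersN. Qed.

(** The first conjunct says that 1, 3, 5 and 7 occur exactly once each, so that they can be set
    aside for [core]. *)
Definition smooth_check (b c d : nat) (ls : seq nat) : bool :=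
  perm_eq [seq x <- smoothN b c d | x \in coreN] coreN &&
  all (fun l => near_equalN (prodsN (powersN 2 l) (restN b c d)) 32) ls.

(** The ranges 4 to 7, 2 to 3, 2 to 3 and 9 to 17 are windows from [L] to [2L - 1], from which all
    greater lengths are tiled. *)
Lemma smooth_check_tiles :
  all (fun b => all (fun c => all (fun d => smooth_check b c d (iota 9 9))
    (iota 2 2)) (iota 2 2)) (iota 4 4).
Proof. by vm_compute. Qed.

(** The case of 9!, which is [2 ^ 7 * 3 ^ 4 * 5 * 7]: its 8 powers of 2 fall short of the window
    starting at 9. *)
Lemma smooth_check9 : smooth_check 5 2 2 [:: 8].
Proof. by vm_compute. Qed.

Lemma flexible_smooth_check b c d l r : 4 <= l -> r <= 2 ^ (l - 2) ->
  perm_eq [seq x <- smoothN b c d | x \in coreN] coreN ->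
  near_equal (prods (powers 2 l) (map N.to_nat (restN b c d))) r ->
  flexible (prods (powers 2 l) (smooth b c d)) (2 ^ (l - 2) - r).
Proof.
move=> l4 rl pc ne.
apply: (@flexible_perm (prods (powers 2 l) core ++
  prods (powers 2 l) (map N.to_nat (restN b c d)))).
  rewrite -(permPl (prods_catr _ _ _)) perm_prods //.
  rewrite -perm_smooth -[core]/(map N.to_nat coreN) -map_cat perm_map //.
  rewrite perm_sym -(perm_filterC (mem coreN)) perm_cat //.
(* The 16 in the tolerance of [flexible_core] is spent by weakening the bound on the rest to
   [16 + r]. *)
have -> : 2 ^ (l - 2) - r = 16 + 2 ^ (l - 2) - (16 + r) by lia.
apply: flexible_cat (flexible_core l4) _; last first.
- by apply: near_equal_weaken ne; lia.
- by lia.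
rewrite sumn_prods sumn_powers2.
have -> : 2 ^ l = 4 * 2 ^ (l - 2) by rewrite -(expnD 2 2); congr (2 ^ _); lia.
have : 2 ^ 2 <= 2 ^ (l - 2) by rewrite leq_exp2l //; lia.
by rewrite /=; lia.
Qed.

Lemma flexible_smooth b c d l :
  4 <= b < 8 -> 2 <= c < 4 -> 2 <= d < 4 -> 9 <= l ->
  flexible (prods (powers 2 l) (smooth b c d)) (2 ^ (l - 3)).
Proof.
move=> hb hc hd l9.
have := smooth_check_tiles.
move=> /allP/(_ b); rewrite mem_iota => /(_ hb).
move=> /allP/(_ c); rewrite mem_iota => /(_ hc).
move=> /allP/(_ d); rewrite mem_iota => /(_ hd) /andP[pc /allP ne].
(* Half of the tolerance [2 ^ (l - 2)] pays for the greedy part; the other half is left. *)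
have e : 2 ^ (l - 2) = 2 * 2 ^ (l - 3) by rewrite -expnS; congr (2 ^ _); lia.
have -> : 2 ^ (l - 3) = 2 ^ (l - 2) - 2 ^ (l - 3) by lia.
apply: flexible_smooth_check => //; [by lia|by lia|].
apply: near_equal_powers l9 => k hk.
have /ne/near_equalP : k \in iota 9 9 by rewrite mem_iota.
by rewrite map_prodsN map_powersN.
Qed.

Lemma flexible_smooth9 : flexible (prods (powers 2 8) (smooth 5 2 2)) 32.
Proof.
have /andP[pc /andP[/near_equalP ne _]] := smooth_check9.
rewrite map_prodsN map_powersN in ne.
by apply: (@flexible_smooth_check 5 2 2 8 32) ne.
Qed.

(* Write sumn s = 4m + r, g = 2 g2 + o and A = o h + g2. In all but the last bin,
   the copies scaled by 1, p, q and pq get m + r A, m, m + r g2 and m, and the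
   weighted sum is the mean because A + q g2 = g h. *)
Lemma flexible_balanced_pq s K g h (p := 2 * g - 1) (q := 2 * h - 1) :
  0 < g -> 0 < h -> K <= sumn s -> 36 * (h + g./2) <= K -> flexible s K ->
  balanced 4 (prods [:: 1; p; q; p * q] s).
Proof.
move=> g0 h0 Ks hK fl.
pose m := sumn s %/ 4; pose r := sumn s %% 4; pose g2 := g./2.
pose A := odd g * h + g2.
have rs : sumn s = 4 * m + r by rewrite /m /r; lia.
have r4 : r < 4 by rewrite /r; lia.
(* The last bin of the first copy is lowered by [3 * (r * A)], at most [9 * A]; in the fourfold
   units of [K] this is [36 * A]. *)
have A9 : 36 * A <= K by rewrite /A /g2; case: (odd g) hK => hK; lia.
have rA : r * A <= 3 * A by nia.
have rg : r * g2 <= r * A by rewrite leq_mul2l /A; lia.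
have sp1 : splits s (load (m + r * A) (m + r * A) (m + r * A) (m + r - 3 * (r * A))).
  by apply: fl; [lia | apply/and4P; split; lia].
have spp : splits s (load m m m (m + r)).
  by apply: fl; [lia | apply/and4P; split; lia].
have spq : splits s
    (load (m + r * g2) (m + r * g2) (m + r * g2) (m + r - 3 * (r * g2))).
  by apply: fl; [lia | apply/and4P; split; lia].
have := load_cat (load_scale 1 sp1) (load_cat (load_scale p spp)
  (load_cat (load_scale q spq) (load_cat (load_scale (p * q) spp) load_nil))).
rewrite -[_ ++ _]/(prods [:: 1; p; q; p * q] s) => sp.
have ea : A + q * g2 = g * h.
  rewrite -[in RHS](odd_double_half g) -/g2 /A /q mulnBl mul1n mulnDl.
  by rewrite addnAC -addnA subnK ?leq_pmull //; lia.
have pq : sumn [:: 1; p; q; p * q] = 4 * (g * h).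
  have : (1 + p) * (1 + q) = 4 * (g * h).
    by rewrite /p /q !subnKC ?muln_gt0 //; lia.
  by rewrite /=; lia.
have e1 : 1 * (m + r * A) + (p * m + (q * (m + r * g2) + (p * q * m + 0)))
    = (4 * m + r) * (g * h).
  have : m * sumn [:: 1; p; q; p * q] + r * (A + q * g2) =
    (4 * m + r) * (g * h) by rewrite pq ea; lia.
  by rewrite /= !mulnDr; lia.
rewrite e1 in sp; apply: (@load_balanced _ ((4 * m + r) * (g * h))).
(* Three bins have the mean as their load, so the total forces it on the fourth. *)
move: sp; set b := (X in load _ _ _ X); move: b => b sp.
have tot := load_sumn sp; rewrite sumn_prods rs pq in tot.
have bE : b = (4 * m + r) * (g * h) by lia.
by rewrite bE in sp.
Qed.

(** * Two primes between m and 2m *)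

(** Pascal's rule gives two terms, equal by symmetry. *)
Lemma central_binS k : 'C(k.*2.+2, k.+1) = 2 * 'C(k.*2.+1, k.+1).
Proof.
rewrite [LHS]binS mul2n -[RHS]addnn; congr (_ + _).
have h : k.+1 <= k.*2.+1 by rewrite ltnS -addnn leq_addr.
by rewrite -(bin_sub h) subSS -{3}addnn addnK.
Qed.

Lemma central_bin_odd k : k.+1 * 'C(k.*2.+1, k.+1) = k.*2.+1 * 'C(k.*2, k).
Proof. by rewrite -mul_bin_diag. Qed.

(** Passing from [m] to [m + 1] multiplies the right-hand side by [4 * (2m + 1) / 2m], which exceeds
    4. *)
Lemma central_bin_lower m : 0 < m -> 4 ^ m <= m.*2 * 'C(m.*2, m).
Proof.
case: m => // m _; elim: m => // m IH.
rewrite expnS doubleS central_binS.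
have := central_bin_odd m.+1; move: IH; rewrite doubleS.
move: ('C(_, _)) ('C(_, _)) (4 ^ _) => x y z; nia.
Qed.

Lemma central_bin_odd_upper k : 'C(k.*2.+1, k.+1) <= 4 ^ k.
Proof.
elim: k => // k IH; rewrite expnS.
have := central_bin_odd k.+1; rewrite doubleS central_binS => h.
rewrite -(leq_pmul2l (ltn0Sn k.+1)) h.
by move: IH; move: ('C(_, _)) (4 ^ k) => x y; nia.
Qed.

Lemma prod_primes_dvd (s : seq nat) N : uniq s ->
  {in s, forall p, prime p && (p %| N)} -> \prod_(p <- s) p %| N.
Proof.
elim: s => [|p s IH] /=; first by rewrite big_nil dvd1n.
move=> /andP[ps us] h; rewrite big_cons.
have /andP[pp pN] : prime p && (p %| N) by apply: h; rewrite inE eqxx.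
rewrite Gauss_dvd ?pN ?IH //.
  by move=> q qs; apply: h; rewrite inE qs orbT.
rewrite big_seq; apply: (big_ind (coprime p)) => [|x y|q qs].
- by rewrite coprimen1.
- by rewrite coprimeMr => -> ->.
have /andP[pq _] : prime q && (q %| N) by apply: h; rewrite inE qs orbT.
by rewrite prime_coprime // dvdn_prime2 //; apply: contraNneq ps => ->.
Qed.

Lemma prime_ndvd_fact p n : prime p -> n < p -> ~~ (p %| n`!).
Proof.
move=> pp; elim: n => [|n IH] np; first by rewrite fact0 dvdn1; case: eqP pp => // ->.
by rewrite factS Euclid_dvdM // negb_or gtnNdvd // IH // ltnW.
Qed.

(** Erdos' induction: a composite last number adds nothing, and for an odd prime [2j + 1] the primes
    in [(j + 1, 2j + 1]] divide ['C(2j + 1, j + 1)], which is at most [4 ^ j]. *)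
Lemma primorial_bound n : \prod_(0 <= p < n.+1 | prime p) p <= 4 ^ n.
Proof.
elim/ltn_ind: n => -[|[|[|n]]] IH //; try by rewrite unlock.
have step : ~~ prime n.+3 -> \prod_(0 <= p < n.+4 | prime p) p <= 4 ^ n.+3.
  move=> np; rewrite big_mkcond big_nat_recr //= (negPf np) muln1 -big_mkcond.
  by apply: leq_trans (IH n.+2 _) _ => //; rewrite leq_exp2l.
have [pn|/step //] := boolP (prime n.+3).
have [k nk] : exists k, n = k.*2.
  by case: (even_prime pn) => // /=; rewrite !negbK => on; exists n./2; lia.
rewrite {}nk in IH step pn *.
have -> : k.*2.+4 = k.+1.*2.+2 by [].
rewrite (@big_cat_nat _ _ _ k.+3) //=; last by lia.
have -> : 4 ^ k.*2.+3 = 4 ^ k.+2 * 4 ^ k.+1 by rewrite -expnD; congr (4 ^ _); lia.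
apply: leq_mul; first by apply: IH; lia.
apply: leq_trans (central_bin_odd_upper k.+1).
apply: dvdn_leq; first by rewrite bin_gt0; lia.
rewrite -big_filter; apply: prod_primes_dvd; first by rewrite filter_uniq ?iota_uniq.
move=> p; rewrite mem_filter mem_index_iota => /andP[pp /andP[lp up]]; rewrite pp /=.
have le : k.+2 <= k.+1.*2.+1 by lia.
have : p %| 'C(k.+1.*2.+1, k.+2) * (k.+2`! * (k.+1.*2.+1 - k.+2)`!).
  by rewrite bin_fact // dvdn_fact // prime_gt0.
have n1 : (p %| k.+2`!) = false by apply/negbTE/prime_ndvd_fact.
have n2 : (p %| (k.+1.*2.+1 - k.+2)`!) = false.
  by apply/negbTE/prime_ndvd_fact => //; lia.
by rewrite (Euclid_dvdM _ _ pp) (Euclid_dvdM k.+2`! _ pp) n1 n2 !orbF.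
Qed.

Lemma sum_leq_indicator N t : \sum_(1 <= k < N.+1) (k <= t) <= t.
Proof.
suff : \sum_(1 <= k < N.+1) (k <= t) <= minn N t by rewrite leq_min => /andP[].
elim: N => [|N IH]; first by rewrite big_geq.
by rewrite big_nat_recr //=; case: (N.+1 <= t) / idP IH => /=; lia.
Qed.

(** Legendre's formula with vanishing terms added, so that the sums for [m] and [m.*2] can share a
    range. *)
Lemma logn_fact_wide p n N : prime p -> n < N ->
  logn p n`! = \sum_(1 <= k < N) n %/ p ^ k.
Proof.
move=> pp nN; rewrite logn_fact // [RHS](@big_cat_nat _ _ _ n.+1) //=.
rewrite [X in _ = _ + X]big_nat [X in _ = _ + X]big1 ?addn0 // => k /andP[nk _].
by rewrite divn_small // (leq_trans nk) // ltnW // ltn_expl // prime_gt1.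
Qed.

Lemma logn_fact_small p n : prime p -> n < p ^ 2 -> logn p n`! = n %/ p.
Proof.
move=> pp np; rewrite (@logn_fact_wide _ _ n.+2) ?ltnS ?leqnSn //.
rewrite big_ltn // expn1 big_nat big1 ?addn0 // => k /andP[k2 _].
by rewrite divn_small // (leq_trans np) // leq_exp2l ?(prime_gt1 pp).
Qed.

Lemma logn_central_bin p m :
  logn p 'C(m.*2, m) + (logn p m`!).*2 = logn p (m.*2)`!.
Proof.
have h : m <= m.*2 by rewrite -addnn leq_addr.
have e : m.*2 - m = m by rewrite -addnn addnK.
rewrite -(bin_fact h) e !lognM ?muln_gt0 ?fact_gt0 ?bin_gt0 //.
by rewrite addnn.
Qed.

(** In Legendre's formula each [k] contributes at most 1 to the exponent, and nothing once [p ^ k]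
    exceeds [2m]; so the exponent is at most the logarithm of [2m] in base [p]. *)
Lemma pfactor_central_bin p m : prime p -> 0 < m ->
  p ^ logn p 'C(m.*2, m) <= m.*2.
Proof.
move=> pp m0; have p1 := prime_gt1 pp.
have m20 : 0 < m.*2 by rewrite double_gt0.
have lo := trunc_logP p1 m20; have hi := trunc_log_ltn m.*2 p1.
apply: leq_trans lo; rewrite leq_exp2l //; set t := trunc_log _ _ in hi *.
have := logn_central_bin p m.
rewrite (@logn_fact_wide p m m.*2.+1) //; last by lia.
rewrite (@logn_fact_wide p _ m.*2.+1) //.
have ind := sum_leq_indicator m.*2 t.
suff : \sum_(1 <= k < m.*2.+1) m.*2 %/ p ^ k <=
  \sum_(1 <= k < m.*2.+1) ((k <= t) + (m %/ p ^ k).*2).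
  by rewrite big_split /= -(big_morph _ doubleD double0); lia.
apply: leq_sum => k _.
have pk0 : 0 < p ^ k by rewrite expn_gt0 prime_gt0.
have [kt|kt] := leqP k t; last first.
  by rewrite divn_small //; apply: leq_trans hi _; rewrite leq_exp2l.
rewrite add1n -ltnS ltn_divLR //.
have := divn_eq m (p ^ k); have := ltn_pmod m pk0.
by move: (m %/ p ^ k) (m %% p ^ k) (p ^ k) => x y z; nia.
Qed.

(** The third hypothesis leaves at most one prime in [(m, 2m]]. It accounts for one factor [2m]; the
    numbers from 0 to [s] account for the other [s + 1]. *)
Lemma central_bin_bound m s : 3 <= m -> m.*2 < s.+1 ^ 2 ->
  (forall p q, prime p -> prime q -> m < p -> p < q -> m.*2 < q) ->
  'C(m.*2, m) <= m.*2 ^ s.+2 * 4 ^ (m.*2 %/ 3).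
Proof.
move=> m3 s2 few; set C := 'C(_, _).
have C0 : 0 < C by rewrite bin_gt0 -addnn leq_addr.
have m0 : 0 < m by lia.
have p_le p : p \in \pi(C) -> p < m.*2.+1.
  rewrite mem_primes => /and3P[pp _ pC].
  rewrite ltnNge; apply/negP => lp; case/negP: (prime_ndvd_fact pp lp).
  have h : m <= m.*2 by lia.
  by rewrite -(bin_fact h) dvdn_mulr.
have -> : C = \prod_(0 <= p < m.*2.+1 | prime p) p ^ logn p C.
  rewrite -{1}(partnT C0) (@widen_partn (maxn C m.*2)) ?leq_maxl //.
  rewrite (@big_cat_nat _ _ _ m.*2.+1) ?ltnS ?leq_maxr //=.
  rewrite [X in _ * X]big_nat_cond [X in _ * X]big1 => [|p]; last first.
    rewrite andbT => /andP[lp _].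
    suff -> : logn p C = 0 by [].
    apply/eqP; rewrite -leqn0 leqNgt logn_gt0.
    by apply: contraTN lp => /p_le; rewrite -leqNgt.
  rewrite muln1 [RHS]big_mkcond; apply: eq_bigr => p _.
  by case: ifP => // np; rewrite lognE np.
(* Primes up to s contribute at most 2m each; beyond s the exponent is at most 1,
   and it is 0 between 2m/3 and m. *)
pose f1 p := if p <= s then m.*2 else 1.
pose f2 p := if p <= m.*2 %/ 3 then p else 1.
pose f3 p := if m < p then p else 1.
apply: (@leq_trans (\prod_(0 <= p < m.*2.+1 | prime p) (f1 p * (f2 p * f3 p)))).
  apply: leq_prod => p pp; have p2 := prime_gt1 pp.
  have f20 : 0 < f2 p by rewrite /f2; case: ifP => _; lia.
  have f30 : 0 < f3 p by rewrite /f3; case: ifP => _; lia.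
  have le2m := pfactor_central_bin pp m0; rewrite -/C in le2m.
  rewrite {1}/f1; have [ps|ps] := leqP p s.
    by apply: leq_trans le2m _; rewrite leq_pmulr // muln_gt0 f20.
  rewrite mul1n.
  have psq : m.*2 < p ^ 2 by apply: leq_trans s2 _; rewrite leq_exp2r.
  have lep : p ^ logn p C <= p.
    rewrite -{3}(expn1 p) leq_exp2l // -ltnS -(ltn_exp2l _ _ p2).
    exact: leq_ltn_trans le2m psq.
  have [pm|pm] := ltnP m p.
    by rewrite /f3 pm; apply: leq_trans lep _; rewrite leq_pmull.
  have [p3|p3] := leqP p (m.*2 %/ 3).
    by rewrite /f2 p3; apply: leq_trans lep _; rewrite leq_pmulr.
  (* Here [m %/ p = 1] and [m.*2 %/ p <= 2], so nothing is left for the exponent in [C]. *)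
  rewrite (_ : logn p C = 0) ?muln_gt0 ?f20 //.
  have := logn_central_bin p m; rewrite -/C.
  rewrite !logn_fact_small //; last by lia.
  have -> : m %/ p = 1.
    apply/eqP; rewrite eqn_leq -ltnS ltn_divLR ?(prime_gt0 pp) //.
    rewrite divn_gt0 ?(prime_gt0 pp) //.
    by lia.
  have : m.*2 %/ p < 3; [rewrite ltn_divLR ?(prime_gt0 pp) //|]; lia.
rewrite !big_split /=.
have -> : m.*2 ^ s.+2 = m.*2 ^ s.+1 * m.*2 by rewrite expnSr.
have -> : m.*2 ^ s.+1 * m.*2 * 4 ^ (m.*2 %/ 3) =
  m.*2 ^ s.+1 * (4 ^ (m.*2 %/ 3) * m.*2) by rewrite -mulnA [m.*2 * _]mulnC.
apply: leq_mul; last apply: leq_mul.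
- have h N : \prod_(0 <= p < N | prime p) f1 p <= m.*2 ^ minn N s.+1.
    elim: N => [|N IH]; first by rewrite big_geq // min0n.
    rewrite big_mkcond big_nat_recr //= -big_mkcond /f1.
    have [Ns|Ns] := leqP N s.
      rewrite (minn_idPl _) // expnSr; case: ifP => _; last first.
        by rewrite muln1 (leq_trans IH) // (minn_idPl _) ?leq_pmulr //; lia.
      by rewrite leq_mul2r orbC (leq_trans IH) // (minn_idPl _) //; lia.
    rewrite if_same muln1 (leq_trans IH) // !(minn_idPr _) //; lia.
  by apply: leq_trans (h _) _; rewrite leq_exp2l ?geq_minr //; lia.
- apply: leq_trans (primorial_bound _); rewrite /f2 -big_mkcondr /=.
  rewrite leq_eqVlt; apply/orP; left; apply/eqP.
  rewrite (@big_nat_widen _ _ _ 0 (m.*2 %/ 3).+1 m.*2.+1) //.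
  by rewrite ltnS leq_div.
rewrite /f3 -big_mkcondr /= -big_filter.
(* [fs] lists the primes in [(m, 2m]] increasingly; a second entry would contradict [few]. *)
set fs := filter _ _.
have fsP p : p \in fs -> [/\ prime p, m < p & p <= m.*2].
  by rewrite mem_filter mem_index_iota => /andP[/andP[-> ->]].
have srt : sorted ltn fs.
  by apply: sorted_filter (iota_ltn_sorted _ _); apply: ltn_trans.
case: fs fsP srt => [|p [|q fs]] fsP /=.
- by rewrite big_nil double_gt0.
- by move=> _; rewrite big_seq1; case: (fsP p); rewrite ?mem_head.
case/andP => pq _; case: (fsP p) => [|pp mp _]; first by rewrite mem_head.
case: (fsP q) => [|qp _]; first by rewrite !inE eqxx orbT.
by rewrite leqNgt (few p q).
Qed.

Lemma two_primes_large m : 2 ^ 13 <= m ->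
  exists p q, [/\ prime p, prime q, m < p, p < q & q <= m.*2].
Proof.
move=> m13.
(* A bounded boolean search makes the existence decidable, so that it can be refuted by
   contradiction. *)
pose has2 := has (fun p => has (fun q => [&& prime p, prime q, m < p & p < q])
  (iota 0 m.*2.+1)) (iota 0 m.*2.+1).
case E: has2.
  case/hasP: E => p _ /hasP[q]; rewrite mem_iota => hq /and4P[pp pq mp lpq].
  by exists p, q; split=> //; lia.
have few p q : prime p -> prime q -> m < p -> p < q -> m.*2 < q.
  move=> pp pq mp lpq; rewrite ltnNge; apply: contraFN E => q2.
  apply/hasP; exists p; first by rewrite mem_iota; lia.
  by apply/hasP; exists q; [rewrite mem_iota; lia | rewrite pp pq mp].
have m20 : 0 < m.*2 by rewrite double_gt0; apply: leq_trans m13; rewrite expn_gt0.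
have lo := trunc_logP (isT : 1 < 4) m20; have hi := trunc_log_ltn m.*2 (isT : 1 < 4).
set k := trunc_log 4 m.*2 in lo hi.
have k7 : 7 <= k.
  by apply: trunc_log_max => //; rewrite -[4 ^ 7]/(2 ^ 14) expnS; lia.
have e4 j : 4 ^ j = 2 ^ j * 2 ^ j by rewrite -expnMn.
(* The threshold [2 ^ 13] yields [k >= 7], where the inequality starts as the equality
   [16 * 8 = 2 ^ 7]. *)
have big : 16 * k.+1 <= 2 ^ k.
  elim: (k) k7 => // j IH; rewrite leq_eqVlt => /orP[/eqP<- //|/IH].
  by rewrite expnS; lia.
have m0 : 0 < m by lia.
have up : 'C(m.*2, m) <= m.*2 ^ (2 ^ k.+1).+2 * 4 ^ (m.*2 %/ 3).
  apply: central_bin_bound few; first by lia.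
  by apply: leq_trans hi _; rewrite e4 -mulnn; apply: leq_mul; lia.
have lower := central_bin_lower m0.
have : 2 ^ m.*2 <= 2 ^ (2 * k.+1 * (2 ^ k.+1).+3 + 2 * (m.*2 %/ 3)).
  rewrite -{1}mul2n expnM; apply: leq_trans lower _.
  rewrite expnD expnM [2 ^ (2 * (_ %/ _))]expnM.
  apply: (@leq_trans (m.*2 ^ (2 ^ k.+1).+3 * 4 ^ (m.*2 %/ 3))).
    by rewrite [m.*2 ^ _.+3]expnS -mulnA leq_mul2l up orbT.
  rewrite leq_mul2r leq_exp2r //; apply/orP; right.
  by rewrite expnM ltnW.
rewrite leq_exp2l // expnS => h.
have : 4 ^ k <= m.*2 by [].
rewrite e4; move: (2 ^ k) big h => x big h lo'.
(* With [16 * k.+1 <= x] the right-hand side is at most about three quarters of [x * x], whereas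
   [x * x <= m.*2]. *)
have : m.*2 <= 3 * (2 * k.+1 * (2 * x).+3) by lia.
by nia.
Qed.

(** For consecutive entries [p, q, r] with [r <= 2p], every [m] with [p <= m < q] has [q] and [r] in
    [(m, 2m]]. *)
Definition prime_chain : seq nat :=
  [:: 7; 11; 13; 19; 23; 37; 43; 73; 83; 139; 163; 277; 317; 547; 631; 1093;
      1259; 2179; 2503; 4357; 5003; 8713; 9973].

Fixpoint chain_steps (s : seq nat) : bool :=
  if s is p :: (q :: r :: _) as s' then
    [&& prime q, prime r, q < r, r <= p.*2 & chain_steps s']
  else true.

(** The bound on [m] is the last entry but one, since the last entry serves only as the larger
    prime. *)
Lemma chain_two_primes s p m : chain_steps (p :: s) -> p <= m ->
  m < last p (belast p s) ->
  exists q r, [/\ prime q, prime r, m < q, q < r & r <= m.*2].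
Proof.
elim: s p => [|q [|r s] IH] p /=; first by move=> _ le /(leq_ltn_trans le); rewrite ltnn.
  by move=> _ le /(leq_ltn_trans le); rewrite ltnn.
case/and5P => pq pr qr rp st pm mq.
have [lt|ge] := ltnP m q; first by exists q, r; split=> //; lia.
exact: (IH q).
Qed.

Lemma two_primes m : 7 <= m ->
  exists p q, [/\ prime p, prime q, m < p, p < q & q <= m.*2].
Proof.
move=> m7; have [|m13] := leqP (2 ^ 13) m; first exact: two_primes_large.
apply: (@chain_two_primes (behead prime_chain) 7); [by vm_compute|by []|].
apply: leq_trans m13 _; by vm_compute.
Qed.

(** * Factorials *)

Lemma perm_divisors N : 0 < N ->
  perm_eq (divisors N) [seq d <- iota 0 N.+1 | d %| N].
Proof.
move=> N0; apply: uniq_perm; first exact: divisors_uniq.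
  by rewrite filter_uniq ?iota_uniq.
move=> d; rewrite mem_filter mem_iota -dvdn_divisors //=.
by case dN: (d %| N); rewrite //= ltnS dvdn_leq.
Qed.

Lemma sum_divisor_set N (P : pred nat) : 0 < N ->
  \sum_(d in divisor_set N | P d) (d : nat) = \sum_(d <- divisors N | P d) d.
Proof.
move=> N0; rewrite (perm_big _ (perm_divisors N0)) big_filter_cond.
by rewrite -/(index_iota 0 N.+1) big_mkord; apply: eq_bigl => d; rewrite inE.
Qed.

Lemma uniq_fst_inj (S T : eqType) (w : seq (S * T)) x i j :
  uniq (map fst w) -> (x, i) \in w -> (x, j) \in w -> i = j.
Proof.
move=> uw wi wj.
have nthx y : (x, y) \in w -> nth x (map fst w) (index (x, y) w) = x.
  by move=> wy; rewrite (nth_map (x, y)) ?index_mem // nth_index.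
have /eqP := etrans (nthx i wi) (esym (nthx j wj)).
rewrite nth_uniq ?size_map ?index_mem // => /eqP e.
by have := nth_index (x, i) wi; rewrite e nth_index // => -[].
Qed.

Lemma balanced_layered k N : 0 < N -> balanced k (divisors N) -> layered k N.
Proof.
move=> N0 [c sp]; split=> //.
(* A positive common sum makes every bin nonempty, so the [k] blocks are distinct. *)
have c0 : 0 < c.
  have := splits_sumn sp; rewrite sum_nat_const; case: c {sp} => // sum0.
  have /perm_sumn := perm_to_rem (divisors_id N0); rewrite sum0 muln0 /=; lia.
have [w [sw wt]] := sp.
have uw : uniq (map fst w) by rewrite -(perm_uniq sw) divisors_uniq.
pose f i (d : nat) := (d, i) \in w.
have f_div i d : f i d -> d %| N.
  rewrite dvdn_divisors // (perm_mem sw) => wd.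
  by apply/mapP; exists (d, i).
pose B i := [set d : 'I_N.+1 | f i d].
have sumB i : \sum_(d in B i) (d : nat) = c.
  rewrite -(wt i).
  have -> : \sum_(d in B i) (d : nat) =
      \sum_(d in divisor_set N | f i d) (d : nat).
    apply: eq_bigl => d; rewrite !inE andb_idl //; exact: f_div.
  rewrite sum_divisor_set // (perm_big _ sw) big_map big_seq_cond.
  rewrite [RHS]big_seq_cond; apply: eq_bigl => -[d j] /=.
  have [wd|] //= := boolP ((d, j) \in w).
  by apply/idP/eqP => [wi|<- //]; apply: uniq_fst_inj uw wd wi.
have Bn0 i : exists d, d \in B i.
  by apply/set0Pn/negP => /eqP B0; move: (sumB i); rewrite B0 big_set0; lia.
have Binj i j d : d \in B i -> d \in B j -> i = j.
  by rewrite !inE => wi wj; apply: uniq_fst_inj uw wi wj.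
exists [set B i | i : 'I_k]; split.
- apply/and3P; split.
  + rewrite cover_imset; apply/eqP/setP => d; rewrite inE.
    apply/bigcupP/idP => [[i _]|dN]; first by rewrite inE; apply: f_div.
    have : (d : nat) \in map fst w by rewrite -(perm_mem sw) -dvdn_divisors.
    by case/mapP => -[d' i] wd /= e; exists i; rewrite // inE /f e.
  + apply/trivIsetP => _ _ /imsetP[i _ ->] /imsetP[j _ ->] nB.
    rewrite -setI_eq0; apply/eqP/setP => d; rewrite in_set0 in_setI.
    by apply/negP => /andP[di dj]; rewrite (Binj _ _ _ di dj) eqxx in nB.
  + by apply/imsetP => -[i _ e]; have [d] := Bn0 i; rewrite -e inE.
- rewrite card_imset ?card_ord // => i j e; have [d di] := Bn0 i.
  by apply: (Binj i j d); rewrite // -e.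
by move=> _ _ /imsetP[i _ ->] /imsetP[j _ ->]; rewrite !sumB.
Qed.

(* The block containing N has sum at least N. *)
Lemma layered_sigma k N : layered k N -> k * N <= sumn (divisors N).
Proof.
move=> [N0 [P [partP cardP eqS]]].
have := @sum_divisor_set N xpredT N0; rewrite -sumnE => <-.
have /and3P[/eqP covP trivP _] := partP.
under eq_bigl do rewrite andbT.
rewrite -covP big_trivIset //=.
have : ord_max \in cover P by rewrite covP inE /=.
case/bigcupP => A AP NA; rewrite -cardP -sum_nat_const.
apply: leq_sum => B BP; rewrite (eqS B A) //.
by rewrite (bigD1 ord_max) //= leq_addr.
Qed.

Lemma fact_not_layered n : 0 < n -> n < 9 -> ~ layered 4 n`!.
Proof.
move=> n0 n9 /layered_sigma; apply/negP; rewrite -ltnNge.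
by move: n n0 n9; do 9 case => //; move=> _ _; vm_compute.
Qed.

(** [M] is [N] without its [p]-part; keeping track of the other valuations lets the splitting be
    iterated. *)
Lemma divisors_split p N : prime p -> 0 < N -> exists M,
  [/\ 0 < M, forall q, prime q -> q != p -> logn q M = logn q N
    & perm_eq (divisors N) (prods (powers p (logn p N).+1) (divisors M))].
Proof.
move=> pp N0; have [M cop e] := pfactor_coprime pp N0.
have M0 : 0 < M by move: N0; rewrite e muln_gt0 => /andP[].
have pk : 0 < p ^ logn p N by rewrite expn_gt0 prime_gt0.
exists M; split=> //.
  move=> q qp qnp; rewrite [in RHS]e lognM // lognX (logn_prime q pp).
  by rewrite (negPf qnp) muln0 addn0.
rewrite {1}e mulnC (perm_trans (divisorsM _ _ _)) ?coprimeXl //.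
by rewrite perm_prods // divisors_pfactor.
Qed.

(** One exponent is tiled at a time, its powers being moved to the front. The length [d] for 7 stays
    fixed, as the case of a single factor 7 requires. *)
Lemma balanced_smooth_tile35 r d Y :
  (forall b c, 4 <= b < 8 -> 2 <= c < 4 -> balanced r (prods (smooth b c d) Y)) ->
  forall b c, 4 <= b -> 2 <= c -> balanced r (prods (smooth b c d) Y).
Proof.
move=> base.
have h1 b c : 4 <= b -> 2 <= c < 4 -> balanced r (prods (smooth b c d) Y).
  move=> hb hc; rewrite /smooth !prodsA; move: b hb.
  apply: balanced_powers_tile => // b hb.
  by rewrite -!prodsA; apply: base.
move=> b c hb hc.
have swap c' : perm_eq (prods (powers 5 c') (prods (powers 3 b)
    (prods (powers 7 d) Y))) (prods (smooth b c' d) Y).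
  by rewrite /smooth !prodsA prodsCA.
apply: perm_balanced (swap c) _; move: c hc.
apply: balanced_powers_tile => // c hc.
by apply: perm_balanced (h1 b c hb hc); rewrite perm_sym.
Qed.

Lemma balanced_smooth_tile r Y :
  (forall b c d, 4 <= b < 8 -> 2 <= c < 4 -> 2 <= d < 4 ->
    balanced r (prods (smooth b c d) Y)) ->
  forall b c d, 4 <= b -> 2 <= c -> 2 <= d -> balanced r (prods (smooth b c d) Y).
Proof.
move=> base b c d hb hc hd.
have swap d' : perm_eq (prods (powers 7 d') (prods (powers 3 b)
    (prods (powers 5 c) Y))) (prods (smooth b c d') Y).
  rewrite /smooth !prodsA (perm_trans (prodsCA _ _ _)) //.
  by rewrite perm_prods // prodsCA.
apply: perm_balanced (swap d) _; move: d hd.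
apply: balanced_powers_tile => // d hd.
suff bal : balanced r (prods (smooth b c d) Y).
  by apply: perm_balanced bal; rewrite perm_sym.
by apply: balanced_smooth_tile35 hb hc => b' c' hb' hc'; apply: base.
Qed.

Lemma divisors_smooth_split N : 0 < N -> exists M,
  [/\ 0 < M, forall q, prime q -> 7 < q -> logn q M = logn q N
    & perm_eq (divisors N)
        (prods (prods (smooth (logn 3 N).+1 (logn 5 N).+1 (logn 7 N).+1)
                  (powers 2 (logn 2 N).+1)) (divisors M))].
Proof.
move=> N0.
have [A [A0 lA pA]] := @divisors_split 2 N isT N0.
have [B [B0 lB pB]] := @divisors_split 3 A isT A0.
have [C [C0 lC pC]] := @divisors_split 5 B isT B0.
have [M [M0 lM pM]] := @divisors_split 7 C isT C0.
exists M; split=> //.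
  by move=> q pq q7; rewrite lM ?lC ?lB ?lA //; lia.
rewrite -(lA 3) // -(lA 5) // -(lB 5) // -(lA 7) // -(lB 7) // -(lC 7) //.
apply: perm_trans pA _.
apply: perm_trans (perm_prods (perm_refl _) pB) _.
apply: perm_trans (perm_prods (perm_refl _) (perm_prods (perm_refl _) pC)) _.
apply: perm_trans (perm_prods (perm_refl _) (perm_prods (perm_refl _)
  (perm_prods (perm_refl _) pM))) _.
rewrite -!prodsA; apply: perm_prods => //.
rewrite [X in perm_eq X _](_ : _ = prods (powers 2 (logn 2 N).+1)
  (smooth (logn 3 A).+1 (logn 5 B).+1 (logn 7 C).+1)); first exact: prodsC.
by rewrite /smooth !prodsA.
Qed.

(** For primes up to [n], [flexible_balanced_pq] asks for a tolerance of at most [27 * n.+1]; the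
    one available is a quarter of this power of 2. Going from [n] to [n + 2] at least doubles the
    power. *)
Lemma two_adic_fact_lower n : 14 <= n -> 108 * n.+1 <= 2 ^ logn 2 n`!.
Proof.
have base m : m \in [:: 14; 15] -> logn 2 m`! = 11.
  by rewrite !inE => /orP[] /eqP->; rewrite logn_fact // unlock; vm_compute.
elim/ltn_ind: n => n IH n14.
have [n16|n16] := ltnP n 16.
  by rewrite base ?inE; [rewrite -[2 ^ 11]/2048|]; lia.
case: n => [|[|n]] // in IH n14 n16 *.
have := IH n ltac:(lia) ltac:(lia).
have : (logn 2 n`!).+1 <= logn 2 n.+2`!.
  rewrite !factS !lognM ?muln_gt0 ?fact_gt0 // addnA -addn1 addnC leq_add2r.
  rewrite addn_gt0 !logn_gt0 !mem_primes /= !dvdn2; lia.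
by rewrite -(@leq_exp2l 2) // expnS; lia.
Qed.

Lemma balanced_pq_smooth n p q : prime p -> prime q -> p <= n -> q <= n ->
  14 <= n -> 7 < p -> 7 < q -> forall b c d, 4 <= b -> 2 <= c -> 2 <= d ->
  balanced 4 (prods (smooth b c d)
    (prods (powers 2 (logn 2 n`!).+1) [:: 1; p; q; p * q])).
Proof.
move=> pp pq pn qn n14 p7 q7; apply: balanced_smooth_tile => b c d hb hc hd.
set l := (logn 2 n`!).+1.
have low := two_adic_fact_lower n14.
have l11 : 11 <= l.
  rewrite /l ltnS -(@leq_exp2l 2) //; apply: leq_trans low.
  by rewrite -[2 ^ 10]/1024; lia.
have e : 2 ^ l.-1 = 4 * 2 ^ (l - 3).
  by rewrite -(expnD 2 2); congr (2 ^ _); lia.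
rewrite -[logn 2 n`!]/(l.-1) e in low.
have op : odd p by case: (even_prime pp) => // pe; rewrite pe in p7.
have oq : odd q by case: (even_prime pq) => // qe; rewrite qe in q7.
have := @flexible_balanced_pq _ (2 ^ (l - 3)) p.+1./2 q.+1./2 _ _ _ _
  (flexible_smooth hb hc hd (leq_trans _ l11)).
have -> : 2 * p.+1./2 - 1 = p by lia.
have -> : 2 * q.+1./2 - 1 = q by lia.
move=> bal; apply: perm_balanced (bal _ _ _ _ _); try lia.
- rewrite (permPl (prodsC _ _)).
  by rewrite (permPl (perm_prods (prodsC _ _) (perm_refl _))) prodsA.
- rewrite sumn_prods sumn_powers2.
  have sp k j : 0 < j -> 0 < sumn (powers k j) by case: j.
  have : 0 < sumn (smooth b c d) by rewrite !sumn_prods !muln_gt0 !sp //; lia.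
  have : 2 ^ l = 2 * 2 ^ l.-1 by rewrite -expnS.
  by rewrite e; nia.
Qed.

Lemma logn_fact_mono p m n : m <= n -> logn p m`! <= logn p n`!.
Proof.
move=> mn; apply: dvdn_leq_log; first exact: fact_gt0.
by rewrite -(bin_fact mn) dvdn_mull // dvdn_mulr.
Qed.

Lemma logn_fact_gt0 p n : prime p -> p <= n -> 0 < logn p n`!.
Proof.
by move=> pp pn; rewrite logn_gt0 mem_primes pp fact_gt0 dvdn_fact ?prime_gt0.
Qed.

Lemma logn3_fact_ge n : 9 <= n -> 4 <= logn 3 n`!.
Proof.
move=> n9; apply: leq_trans (logn_fact_mono 3 n9).
by rewrite logn_fact // unlock; vm_compute.
Qed.

Lemma layered_fact_large n : 14 <= n -> layered 4 n`!.
Proof.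
move=> n14; apply: balanced_layered; first exact: fact_gt0.
have [p [q [pp pq mp lpq q2]]] := @two_primes n./2 ltac:(lia).
have [p7 q7] : 7 < p /\ 7 < q by lia.
have qn : q <= n by lia.
have pn : p <= n by lia.
have N0 := fact_gt0 n.
(* As [r > n / 2] and [r > 7], the square of [r] exceeds [n], and Legendre's formula reduces to
   [n %/ r = 1]. *)
have log1 r : prime r -> n./2 < r -> r <= n -> 7 < r -> logn r n`! = 1.
  move=> pr mr rn r7; rewrite logn_fact_small //; last by rewrite -mulnn; nia.
  by apply/eqP; rewrite eqn_leq -ltnS ltn_divLR ?divn_gt0 ?(prime_gt0 pr) //; lia.
have [M [M0 lM pM]] := divisors_smooth_split N0.
have [M1 [M10 lM1 pM1]] := divisors_split pp M0.
have [M2 [M20 lM2 pM2]] := divisors_split pq M10.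
have qp : q != p by rewrite neq_ltn lpq orbT.
have lp : logn p M = 1 by rewrite lM // log1.
have lq : logn q M1 = 1 by rewrite lM1 // lM // log1 //; lia.
rewrite lp in pM1; rewrite lq in pM2.
(* [M2] collects the prime factors other than 2, 3, 5, 7, [p] and [q]. *)
have := balanced_prods (divisors M2) (balanced_pq_smooth pp pq pn qn n14 p7 q7
  (b := (logn 3 n`!).+1) (c := (logn 5 n`!).+1) (d := (logn 7 n`!).+1) _ _ _).
move=> bal; apply: perm_balanced (bal _ _ _); last 3 first.
- by have := @logn3_fact_ge n; lia.
- by rewrite ltnS logn_fact_gt0 //; lia.
- by rewrite ltnS logn_fact_gt0 //; lia.
rewrite perm_sym (perm_trans pM) // -[X in perm_eq _ (prods X _)]prodsA.
rewrite [X in perm_eq _ X]prodsA perm_prods //.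
apply: perm_trans pM1 _; apply: perm_trans (perm_prods (perm_refl _) pM2) _.
rewrite -prodsA perm_prods // /powers /= /prods /= !muln1 !mul1n.
by rewrite perm_cons (perm_catCA [:: q] [:: p] [:: p * q]).
Qed.

Lemma layered_fact_small n : 9 <= n < 14 -> layered 4 n`!.
Proof.
move=> /andP[n9 n14]; apply: balanced_layered; first exact: fact_gt0.
have [M [M0 _ pM]] := divisors_smooth_split (fact_gt0 n).
have l7 : logn 7 n`! = 1.
  rewrite logn_fact_small //; last by apply: ltn_trans n14 _.
  by apply/eqP; rewrite eqn_leq -ltnS ltn_divLR // n14 divn_gt0 //; lia.
(* The powers 1 and 7 contribute the factor 8 to the sum. *)
have sum4 l b c : 4 %| sumn (prods (powers 2 l) (smooth b c 2)).
  by rewrite !sumn_prods mulnA dvdn_mull.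
rewrite l7 in pM.
suff bal : balanced 4 (prods (smooth (logn 3 n`!).+1 (logn 5 n`!).+1 2)
    (powers 2 (logn 2 n`!).+1)).
  have := balanced_prods (divisors M) bal; apply: perm_balanced.
  by rewrite perm_sym.
have [n10|n10] := leqP 10 n.
  have l2 : 8 <= logn 2 n`!.
    apply: leq_trans (logn_fact_mono 2 n10).
    by rewrite logn_fact // unlock; vm_compute.
  apply: balanced_smooth_tile35.
  - move=> b c hb hc; apply: (perm_balanced (prodsC _ _)).
    exact: flexible_balanced (flexible_smooth hb hc _ _) _.
  - by have := logn3_fact_ge n9; lia.
  - by rewrite ltnS logn_fact_gt0 //; lia.
(* Only [n = 9] remains, where the lengths are exactly those of [flexible_smooth9]. *)
have -> : logn 3 n`! = 4.
  have -> : n = 9 by lia.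
  by rewrite logn_fact // unlock; vm_compute.
have -> : logn 5 n`! = 1.
  by rewrite logn_fact_small //; [lia | apply: ltn_trans n10 _].
have -> : logn 2 n`! = 7.
  have -> : n = 9 by lia.
  by rewrite logn_fact // unlock; vm_compute.
by apply: (perm_balanced (prodsC _ _)); apply: flexible_balanced flexible_smooth9 _.
Qed.

Theorem theorem5p18 (n : nat) (hn : 0 < n) : layered 4 n`! <-> 9 <= n.
Proof.
split=> [lay|n9]; first by rewrite leqNgt; apply/negP => /(fact_not_layered hn).
have [n14|n14] := leqP 14 n; first exact: layered_fact_large.
by apply: layered_fact_small; rewrite n9.
Qed.
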